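(* Let $(X,\mathcal{A},\mu)$ be a non-atomic probability space, let $\mathcal{T}$ be a tree in $\mathcal{A}$, and let $\mathcal{M}_{\mathcal{T}}$ be the associated dyadic maximal operator. For all real numbers $f,M,k$ with $0<f\le M$ and $k\in(0,1]$, the quantity $$\sup\Big\{ \int_K \mathcal{M}_{\mathcal{T}}\phi \, d\mu \;:\; \phi:X\to [0,+\infty) \text{ measurable},\ \int_X \phi\, d\mu=f,\ \|\phi\|_{\infty}=M,\ K\subset X \text{ measurable},\ \mu(K)=k \Big\}$$ is equal to $$\begin{cases} kM & \text{if } 0<k\le \frac{f}{M},\\[2mm] f+f\log\big(\frac{Mk}{f}\big) & \text{if } \frac{f}{M}<k\le 1.\end{cases}$$
   Context: Let $(X,\mathcal{A},\mu)$ be a non-atomic probability space. A collection $\mathcal{T}$ of measurable sets is called a tree in $\mathcal{A}$ if: (i) $X\in\mathcal{T}$ and every $I\in\mathcal{T}$ has positive measure; (ii) to every $I\in\mathcal{T}$ corresponds a countable (finite or infinite) family $C(I)\subset\mathcal{T}$, containing at least two elements, such that (a) the elements of $C(I)$ are almost pairwise disjoint, i.e. $\mu(J\cap J')=0$ for $J,J'\in C(I)$ with $J\ne J'$, and (b) $I=\bigcup C(I)$ (the union of the members of $C(I)$); (iii) defining $\mathcal{T}_{(0)}=\{X\}$ and $\mathcal{T}_{(n+1)}=\bigcup\{C(I): I\in\mathcal{T}_{(n)}\}$ for all $n$, one has $\mathcal{T}=\bigcup_{n=0}^{\infty}\mathcal{T}_{(n)}$; (iv) $\lim_{n\to\infty}\sup\{\mu(I):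 I\in\mathcal{T}_{(n)}\}=0$. The dyadic maximal operator associated to $\mathcal{T}$ is defined, for $\phi\in L^1(\mu)$ and $x\in X$, by $$\mathcal{M}_{\mathcal{T}}\phi(x)=\sup\Big\{\frac{1}{\mu(I)}\int_I|\phi|\,d\mu : x\in I\in\mathcal{T}\Big\}.$$ Here $\|\phi\|_\infty$ denotes the essential supremum of $|\phi|$ with respect to $\mu$, and $\log$ is the natural logarithm. *)

(* Defs.v *)
From HB Require Import structures.
From mathcomp Require Import all_boot all_order all_algebra.
From mathcomp Require Import all_classical all_reals all_analysis.

Set Implicit Arguments.
Unset Strict Implicit.
Unset Printing Implicit Defensive.

Import Order.TTheory GRing.Theory Num.Theory.
Import numFieldNormedType.Exports.

Local Open Scope classical_set_scope.
Local Open Scope ring_scope.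
Local Open Scope ereal_scope.

Section dyadic_tree.
Context d (X : measurableType d) (R : realType) (mu : {measure set X -> \bar R}).

Definition nonatomic : Prop :=
  forall A : set X, measurable A -> 0 < mu A ->
    exists B : set X, [/\ measurable B, B `<=` A, 0 < mu B & mu B < mu A].

Fixpoint tree_level (C : set X -> set (set X)) (n : nat) : set (set X) :=
  if n is m.+1 then \bigcup_(I in tree_level C m) C I else [set setT].

(* The values of [C] outside [T] are irrelevant. *)
Record is_tree_with (T : set (set X)) (C : set X -> set (set X)) : Prop := {
  tree_measurable : forall I, T I -> measurable I;
  tree_root : T setT;
  tree_pos : forall I, T I -> 0 < mu I;
  children_sub : forall I, T I -> C I `<=` T;
  children_countable : forall I, T I -> countable (C I);
  children_two : forall I, T I -> exists J J', [/\ C I J, C I J' & J <> J'];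
  children_disjoint : forall I, T I ->
    forall J J', C I J -> C I J' -> J <> J' -> mu (J `&` J') = 0;
  children_cover : forall I, T I -> I = \bigcup_(J in C I) J;
  tree_levels : T = \bigcup_n tree_level C n;
  tree_shrink :
    (fun n => ereal_sup [set mu I | I in tree_level C n]) @ \oo --> (0 : \bar R)
}.

Definition is_tree (T : set (set X)) : Prop := exists C, is_tree_with T C.

Definition dyadic_maximal (T : set (set X)) (phi : X -> R) (x : X) : \bar R :=
  ereal_sup [set (\int[mu]_(y in I) `|phi y|%:E) / mu I | I in [set I | T I /\ I x]].

End dyadic_tree.

(* Main.v *)
(** Weak-type estimate: [{Mphi > l}] is, up to null sets, the disjoint union of
the maximal tree elements on which the average of [phi] exceeds [l], hence has
measure at most [f / l]. The upper bound integrates [min k (f / l)] over [l] in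
[0, M], here as a Riemann sum along the geometric progression [(f / k) q ^ n]
with [q ^ N = M k / f].

Extremizers: take [K] of measure [k] that is a union of tree elements. In each
maximal one choose a union of tree elements of relative measure [t], and repeat
this [N] times inside the chosen elements, where [t ^ N = f / (M k)]; let [A] be
the last set and [phi = M 1_A]. On a set of the [n]-th generation [Mphi] is at
least [M t ^ (N - n)], so the integral over [K] is at least
[f (1 + N (1 - t))]. Both bounds converge to [f + f ln (M k / f)] when [N] goes
to infinity. *)

Require Import Defs.
From HB Require Import structures.
From mathcomp Require Import all_boot all_order all_algebra.
From mathcomp Require Import all_classical all_reals all_analysis.
From mathcomp Require Import measurable_realfun ess_sup_inf ring.

Set Implicit Arguments.
Unset Strict Implicit.
Unset Printing Implicit Defensive.

Import Order.TTheory GRing.Theory Num.Theory.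
Import numFieldNormedType.Exports.

Local Open Scope classical_set_scope.
Local Open Scope ring_scope.
Local Open Scope ereal_scope.

(** * Countable families as sequences, and almost disjoint unions *)

Lemma countable_sequence (U : Type) (S : set (set U)) : countable S ->
  exists e : nat -> set U, [/\ forall n, S (e n) \/ e n = set0,
    forall I, S I -> exists n, e n = I &
    forall m n, m <> n -> e m = e n -> e m = set0].
Proof.
move=> /countable_injP[r r_inj].
(* At most one member of [S] has code [n], so this union is that member, or empty when [n] codes
   nothing. Only the empty set can therefore occur twice. *)
pose e n := \bigcup_(I in [set I | S I /\ r I = n]) I.
have eE I : S I -> e (r I) = I.
  move=> SI; apply/seteqP; split=> [x [J [SJ rJ] Jx]|x Ix]; last by exists I.
  by rewrite (r_inj I J) ?inE// rJ.
have e0 n : (exists2 I, S I & r I = n) \/ e n = set0.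
  have [[I SI rI]|nI] := pselect (exists2 I, S I & r I = n); first by left; exists I.
  by right; rewrite -subset0 => x [I [SI rI] _]; apply: nI; exists I.
exists e; split=> [n|I SI|m n mn]; [|by exists (r I); exact: eE|].
- by have [[I SI <-]|] := e0 n; [left; rewrite eE|right].
- have [[I SI mI]|//] := e0 m; have [[J SJ nJ]|-> //] := e0 n.
  by rewrite -mI -nJ !eE// => IJ; case: mn; rewrite -mI -nJ IJ.
Qed.

Section ae_disjoint_sequence.
Context d (X : measurableType d) (R : realType) (mu : {measure set X -> \bar R}).

(** Making the sequence disjoint removes from [F n] only its overlaps with finitely many earlier
    terms, a null set that the integral does not see. *)
Lemma ge0_integral_bigcup_ae (F : nat -> set X) (h : X -> \bar R) :
  (forall n, measurable (F n)) ->
  (forall m n, m <> n -> mu (F m `&` F n) = 0) ->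
  measurable_fun [set: X] h -> (forall x, 0 <= h x) ->
  \int[mu]_(x in \bigcup_n F n) h x = \sum_(n <oo) \int[mu]_(x in F n) h x.
Proof.
move=> mF F0 mh h0; rewrite seqDU_bigcup_eq ge0_integral_bigcup//; last 2 first.
- by move=> n; apply: measurableD => //; exact: bigsetU_measurable.
- exact: measurable_funTS.
apply: eq_eseriesr => n _.
have mN : measurable (F n `&` \big[setU/set0]_(k < n) F k).
  by apply: measurableI => //; exact: bigsetU_measurable.
rewrite [RHS](ge0_negligible_integral mN)//; last 2 first.
- exact: measurable_funTS.
- rewrite big_distrr/=; apply/eqP; rewrite -measure_le0.
  apply: (@le_trans _ _ (\sum_(k < n) mu (F n `&` F k))).
    apply: (@content_subadditive _ _ _ mu _ (fun k => F n `&` F k) n) => //.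
    + by move=> k _; exact: measurableI.
    + by apply: bigsetU_measurable => k _; exact: measurableI.
  by rewrite big1// => k _; apply: F0 => nk; have := ltn_ord k; rewrite -nk ltnn.
by congr integral; rewrite /seqDU setDIr setDv set0U.
Qed.

Lemma measure_bigcup_ae (F : nat -> set X) :
  (forall n, measurable (F n)) ->
  (forall m n, m <> n -> mu (F m `&` F n) = 0) ->
  mu (\bigcup_n F n) = \sum_(n <oo) mu (F n).
Proof.
move=> mF F0.
rewrite -[LHS]mul1e -integral_cst ?ge0_integral_bigcup_ae//; last first.
  exact: bigcup_measurable.
by apply: eq_eseriesr => n _; rewrite integral_cst// mul1e.
Qed.

End ae_disjoint_sequence.

(** * Levels, ancestors and maximal elements of a tree *)

Section tree.
Context d (X : measurableType d) (R : realType) (mu : {measure set X -> \bar R}).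
Context (T : set (set X)) (C : set X -> set (set X)).
Hypothesis treeT : is_tree_with mu T C.

Lemma tree_level_sub n : tree_level C n `<=` T.
Proof. by rewrite [X in _ `<=` X](tree_levels treeT); exact: bigcup_sup. Qed.

Lemma tree_in_level I : T I -> exists n, tree_level C n I.
Proof. by rewrite (tree_levels treeT) => -[n _]; exists n. Qed.

Lemma countable_tree : countable T.
Proof.
rewrite (tree_levels treeT); apply: bigcup_countable => // n _.
elim: n => [|n IHn] /=; first exact: countable1.
apply: bigcup_countable => // I nI; apply: (children_countable treeT).
exact: tree_level_sub nI.
Qed.

Lemma measurable_tree_bigcup (S : set (set X)) : S `<=` T ->
  measurable (\bigcup_(I in S) I).
Proof.
move=> ST; have /countable_sequence[e [eS Se _]] : countable S.
  by apply: sub_countable countable_tree; exact: subset_card_le.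
rewrite (_ : \bigcup_(I in S) I = \bigcup_n e n).
  apply: bigcupT_measurable => n; case: (eS n) => [/ST|->//].
  exact: (tree_measurable treeT).
apply/seteqP; split=> [x [I SI Ix]|x [n _ nx]].
  by have [n en] := Se _ SI; exists n; rewrite ?en.
by case: (eS n) => [Sn|n0]; [exists (e n)|rewrite n0 in nx].
Qed.

(** Induction on the level: children of one parent overlap in a null set by definition, and children
    of distinct parents overlap inside the overlap of the parents. *)
Lemma tree_level_ae_disjoint n I J : tree_level C n I -> tree_level C n J ->
  I <> J -> mu (I `&` J) = 0.
Proof.
elim: n I J => [I J /= -> -> //|n IHn I J [I' nI' I'I] [J' nJ' J'J] IJ].
have TI' := tree_level_sub nI'; have TJ' := tree_level_sub nJ'.
have [I'J'|I'J'] := pselect (I' = J').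
  by rewrite -I'J' in J'J; exact: (children_disjoint treeT TI').
have mT := tree_measurable treeT.
have subC K L : T K -> C K L -> T L /\ L `<=` K.
  move=> TK KL; split; first exact: (children_sub treeT TK).
  by rewrite [X in _ `<=` X](children_cover treeT TK); exact: bigcup_sup.
have [TI II'] := subC _ _ TI' I'I; have [TJ JJ'] := subC _ _ TJ' J'J.
by apply: subset_measure0 (IHn _ _ nI' nJ' I'J');
  [apply: measurableI; exact: mT..|exact: setISS].
Qed.

Lemma tree_ancestor m n J : tree_level C (n + m) J ->
  exists2 I, tree_level C n I & J `<=` I.
Proof.
elim: m J => [|m IHm] J; first by rewrite addn0 => nJ; exists J.
rewrite addnS => -[K /[dup] nK /IHm[I nI KI] KJ]; exists I => //.
apply: subset_trans KI.
rewrite [X in _ `<=` X](children_cover treeT (tree_level_sub nK)).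
exact: bigcup_sup.
Qed.

Lemma tree_descendant m n I x : tree_level C n I -> I x ->
  exists J, [/\ tree_level C (n + m) J, J `<=` I & J x].
Proof.
move=> nI Ix; elim: m => [|m [J [mJ JI Jx]]]; first by exists I; split; rewrite ?addn0.
have TJ := tree_level_sub mJ.
have /[dup] := Jx; rewrite {1}(children_cover treeT TJ) => -[K JK Kx] _.
exists K; split=> //; first by rewrite addnS; exists J.
apply: subset_trans JI; rewrite [X in _ `<=` X](children_cover treeT TJ).
exact: bigcup_sup.
Qed.

(** The sequence enumerates [D], the elements of [S] contained in no element of [S] of a smaller
    level. They still cover, since a point may be assigned to an element of [S] of least level
    around it. *)
Lemma tree_maximal_sequence (S : set (set X)) : S `<=` T ->
  exists J : nat -> set X, [/\ forall n, S (J n) \/ J n = set0,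
    \bigcup_n J n = \bigcup_(I in S) I &
    forall m n, m <> n -> mu (J m `&` J n) = 0].
Proof.
move=> ST.
pose D := [set J | S J /\ exists2 n, tree_level C n J &
  forall m J', (m < n)%N -> tree_level C m J' -> S J' -> ~ J `<=` J'].
have /countable_sequence[e [eD De einj]] : countable D.
  apply: sub_countable countable_tree; apply: subset_card_le.
  by move=> J [/ST].
exists e; split=> [n||m n mn].
- by case: (eD n) => [[]|]; [left|right].
- apply/seteqP; split=> [x [n _ nx]|x [I SI Ix]].
    by case: (eD n) => [[Sn _]|n0]; [exists (e n)|rewrite n0 in nx].
  have lvl : exists n, `[< exists J, [/\ S J, tree_level C n J & J x] >].
    by have [n nI] := tree_in_level (ST _ SI); exists n; apply/asboolP; exists I.
  have [n /asboolP[J [SJ nJ Jx]] nmin] := ex_minnP lvl.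
  have [|k ek] := De J.
    (* An element of [S] containing [J] also contains [x], so its level is at least [n]. *)
    split=> //; exists n => // m J' mn mJ' SJ' JJ'.
    have : (n <= m)%N by apply/nmin/asboolP; exists J'; split=> //; exact: JJ'.
    by rewrite leqNgt mn.
  by exists k; rewrite ?ek.
- have [em0|em0] := pselect (e m = set0); first by rewrite em0 set0I measure0.
  have [en0|en0] := pselect (e n = set0); first by rewrite en0 setI0 measure0.
  have emn : e m <> e n by move=> /(einj _ _ mn).
  case: (eD m) => // -[Sm [p pm mmax]]; case: (eD n) => // -[Sn [q qn nmax]].
  wlog pq : m n mn em0 en0 emn p q pm qn Sm Sn mmax nmax / (p <= q)%N.
    have [pq|/ltnW qp] := leqP p q; first by move=> /(_ m n mn _ _ _ p q); exact.
    rewrite setIC => /(_ n m _ _ _ _ q p); apply => //.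
    - by move=> nm; exact: mn.
    - by move=> nm; exact: emn.
  (* The deeper element [e n] lies in an ancestor [I] of level [p]. If [I] is [e m], then either the
     levels agree, or [e n] is not maximal; otherwise [e m] and [I] are distinct elements of one
     level. *)
  have := qn; rewrite -(subnKC pq) => /tree_ancestor[I pI nI].
  have [mI|mI] := pselect (e m = I).
    move: pq; rewrite leq_eqVlt => /predU1P[pq|pq].
    - by apply: tree_level_ae_disjoint emn; [exact: pm|rewrite pq].
    - by case: (nmax p (e m) pq pm Sm); rewrite mI.
  apply: subset_measure0 (tree_level_ae_disjoint pm pI mI).
  - by apply: measurableI; apply: (tree_measurable treeT); exact: ST.
  - by apply: measurableI; apply: (tree_measurable treeT);
      [exact: ST|exact: tree_level_sub pI].
  - exact: setIS.
Qed.

End tree.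

(** * Small elements and unions of tree elements of prescribed measure *)

Section probability_tree.
Context d (X : measurableType d) (R : realType) (mu : probability X R).
Context (T : set (set X)) (C : set X -> set (set X)).
Hypothesis treeT : is_tree_with mu T C.

Let mT I : T I -> measurable I := @tree_measurable _ _ _ _ _ _ treeT I.

(** The bound at one level passes to all deeper levels through ancestors. *)
Lemma tree_small (e : R) : (0 < e)%R ->
  exists n, forall m I, tree_level C (m + n) I -> mu I < e%:E.
Proof.
move=> e0; have /(tree_shrink treeT) : nbhs (0 : \bar R) [set y | y < e%:E].
  apply: open_nbhs_nbhs; split; [exact: open_ereal_lt_ereal|by rewrite /= lte_fin].
move=> [n _ /(_ n (leqnn n)) /= ne]; exists n => m I; rewrite addnC => mnI.
have [J nJ IJ] := tree_ancestor treeT mnI.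
apply: le_lt_trans ne; apply: (@le_trans _ _ (mu J)).
  rewrite le_measure ?inE//; apply: mT; [exact: (tree_level_sub treeT mnI)|].
  exact: (tree_level_sub treeT nJ).
by apply: ereal_sup_ubound; exists J.
Qed.

(* Running through the tree, add an element whenever the measure stays below
   [a]; were the result smaller than [a], it would contain all small elements
   inside the given union, hence the union itself. *)
Lemma tree_bigcup_measure (S : set (set X)) (a : \bar R) : S `<=` T ->
  0 <= a -> a <= mu (\bigcup_(I in S) I) ->
  exists S', [/\ S' `<=` T, \bigcup_(I in S') I `<=` \bigcup_(I in S) I &
    mu (\bigcup_(I in S') I) = a].
Proof.
move=> ST a0 aS; set U := \bigcup_(I in S) I.
have mU : measurable U by exact: (measurable_tree_bigcup treeT).
have afin : a \is a fin_num.
  by rewrite ge0_fin_numE// (le_lt_trans aS)// ltey_eq fin_num_measure.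
have [e [eT Te _]] := countable_sequence (countable_tree treeT).
have me n : measurable (e n) by case: (eT n) => [/mT//|->].
pose fits V n := `[< e n `<=` U /\ mu (V `|` e n) <= a >].
have [V [V0 VS]] : exists V : nat -> set X, V 0%N = set0 /\
    forall n, V n.+1 = if fits (V n) n then V n `|` e n else V n.
  by exists (fix V n := if n is m.+1 then
    if fits (V m) m then V m `|` e m else V m else set0).
have mV n : measurable (V n).
  by elim: n => [|n IHn]; rewrite ?V0// VS; case: ifP => // _; exact: measurableU.
have VU n : V n `<=` U.
  elim: n => [|n IHn]; rewrite ?V0// VS; case: ifPn => // /asboolP[eU _].
  by rewrite subUset.
have Va n : mu (V n) <= a.
  elim: n => [|n IHn]; first by rewrite V0 measure0.
  by rewrite VS; case: ifPn => // /asboolP[].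
have ndV : nondecreasing_seq V.
  apply/nondecreasing_seqP => n; apply/subsetPset; rewrite VS.
  by case: ifP => _ x //; left.
pose W := \bigcup_n V n.
have mW : measurable W by exact: bigcupT_measurable.
have WU : W `<=` U by apply: bigcup_sub => n _; exact: VU.
have Wa : mu W <= a.
  have VW := @nondecreasing_cvg_mu _ _ _ mu _ mV mW ndV.
  rewrite -(cvg_lim _ VW)//; apply: lime_le; first by apply/cvg_ex; exists (mu W).
  by apply: nearW => n; exact: Va.
(* All tree elements inside [W] are taken, not only those added on the way: the union is the same
   and no record of the choices is needed. *)
pose S' := [set I | T I /\ I `<=` W].
have S'W : \bigcup_(I in S') I = W.
  apply/seteqP; split=> [x [I [_ IW] /IW//]|x [n _]].
  elim: n => [|n IHn]; rewrite ?V0// VS; case: ifPn => // nV [/IHn//|enx].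
  case: (eT n) => [Tn|n0]; last by rewrite n0 in enx.
  exists (e n) => //; split=> // y eny; exists n.+1 => //.
  by rewrite VS nV; right.
exists S'; rewrite S'W; split=> //; first by move=> I [].
apply/eqP; rewrite eq_le Wa/= leNgt; apply/negP => Wlta.
have Wfin : mu W \is a fin_num by exact: fin_num_measure.
have [|n small] := @tree_small (fine a - fine (mu W)).
  by rewrite subr_gt0 -lte_fin !fineK.
suff UW : U `<=` W.
  by have := lt_le_trans Wlta aS; rewrite ltNge le_measure ?inE.
move=> x [I SI Ix]; have [m mI] := tree_in_level treeT (ST _ SI).
have [J [mnJ JI Jx]] := tree_descendant treeT n mI Ix.
have [p ep] := Te _ (tree_level_sub treeT mnJ).
exists p.+1 => //; rewrite VS (_ : fits _ _); first by right; rewrite ep.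
apply/asboolP; rewrite ep; split; first by move=> y /JI Iy; exists I.
have mJ : measurable J by rewrite -ep.
apply: (le_trans (measureU2 _ _ _)) => //.
apply: (@le_trans _ _ (mu W + mu J)).
  by rewrite leeD2r// le_measure ?inE//; exact: bigcup_sup.
have := small _ _ mnJ; rewrite EFinB !fineK// => /ltW.
by rewrite leeBrDl.
Qed.

(** * Averages over tree elements and the maximal operator *)

Lemma tree_fineK I : T I -> (fine (mu I))%:E = mu I.
Proof. by move=> TI; rewrite fineK// fin_num_measure//; exact: mT. Qed.

Lemma tree_fine_gt0 I : T I -> (0 < fine (mu I))%R.
Proof. by move=> TI; rewrite -lte_fin tree_fineK// (tree_pos treeT). Qed.

Lemma lee_tree_div I (x y : \bar R) : T I -> (x <= y / mu I) = (x * mu I <= y).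
Proof.
move=> TI; have I0 := tree_fine_gt0 TI.
by rewrite -(tree_fineK TI) inver gt_eqF// lee_pdivlMr.
Qed.

Lemma lee_div_tree I (x y : \bar R) : T I -> (x / mu I <= y) = (x <= y * mu I).
Proof.
move=> TI; have I0 := tree_fine_gt0 TI.
by rewrite -(tree_fineK TI) inver gt_eqF// lee_pdivrMr.
Qed.

Lemma lte_tree_div I (x y : \bar R) : T I -> (x < y / mu I) = (x * mu I < y).
Proof.
move=> TI; have I0 := tree_fine_gt0 TI.
by rewrite -(tree_fineK TI) inver gt_eqF// lte_pdivlMr.
Qed.

Lemma average_le_maximal phi I x : T I -> I x ->
  (\int[mu]_(y in I) `|phi y|%:E) / mu I <= dyadic_maximal mu T phi x.
Proof. by move=> TI Ix; apply: ereal_sup_ubound; exists I. Qed.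

(** This description gives both the measurability of the maximal function, the tree being countable,
    and the covering used in the weak-type estimate. *)
Lemma maximal_gtE phi (r : \bar R) :
  [set x | r < dyadic_maximal mu T phi x] =
  \bigcup_(I in [set I | T I /\ r < (\int[mu]_(y in I) `|phi y|%:E) / mu I]) I.
Proof.
apply/seteqP; split=> x /=.
  by move=> /ereal_sup_gt[_ [I [TI Ix] <-] rI]; exists I.
by move=> [I [TI rI] Ix]; exact: lt_le_trans rI (average_le_maximal _ TI Ix).
Qed.

Lemma measurable_maximal phi : measurable_fun [set: X] (dyadic_maximal mu T phi).
Proof.
apply: (measurability _ (ErealGenOInfty.measurableE R)) => // _ [_ [r ->] <-].
rewrite setTI (_ : _ @^-1` _ = [set x | r%:E < dyadic_maximal mu T phi x]); last first.
  by apply/seteqP; split=> x /=; rewrite in_itv/= andbT.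
by rewrite maximal_gtE; apply: (measurable_tree_bigcup treeT) => I [].
Qed.

Lemma maximal_ge0 phi x : 0 <= dyadic_maximal mu T phi x.
Proof.
apply: le_trans (average_le_maximal _ (tree_root treeT) _) => //.
by rewrite lee_tree_div ?mul0e ?integral_ge0//; exact: (tree_root treeT).
Qed.

Lemma le_maximal (phi psi : X -> R) x :
  measurable_fun [set: X] phi -> measurable_fun [set: X] psi ->
  (forall y, `|phi y| <= `|psi y|)%R ->
  dyadic_maximal mu T phi x <= dyadic_maximal mu T psi x.
Proof.
move=> mphi mpsi phipsi; apply: ge_ereal_sup => _ [I [TI Ix] <-].
apply: le_trans (average_le_maximal psi TI Ix).
apply: lee_wpmul2r; first by rewrite inve_ge0.
apply: ge0_le_integral => //.
- exact: mT.
- by apply/measurable_EFinP; apply: measurableT_comp => //; exact: measurable_funTS.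
- by apply/measurable_EFinP; apply: measurableT_comp => //; exact: measurable_funTS.
- by move=> y _; rewrite lee_fin.
Qed.

Lemma maximal_le_bound (phi : X -> R) (M : R) x :
  measurable_fun [set: X] phi -> (0 <= M)%R ->
  {ae mu, forall x, (`|phi x| <= M)%R} -> dyadic_maximal mu T phi x <= M%:E.
Proof.
move=> mphi M0 phiM; apply: ge_ereal_sup => _ [I [TI Ix] <-].
suff : (\int[mu]_(y in I) `|phi y|%:E) / mu I <= M%:E by [].
rewrite lee_div_tree// -integral_cst//; last exact: mT.
apply: ae_ge0_le_integral => //.
- exact: mT.
- by apply/measurable_EFinP; apply: measurableT_comp => //; exact: measurable_funTS.
- by apply: filterS phiM => y yM _; rewrite lee_fin.
Qed.

Lemma maximal_weak_type (phi : X -> R) (l : R) :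
  measurable_fun [set: X] phi -> (0 <= l)%R ->
  l%:E * mu [set x | l%:E < dyadic_maximal mu T phi x]
    <= \int[mu]_x `|phi x|%:E.
Proof.
move=> mphi l0; rewrite maximal_gtE; set S := [set I | _ /\ _].
have ST : S `<=` T by move=> I [].
have [J [JS JE J0]] := tree_maximal_sequence treeT ST.
have mJ n : measurable (J n) by case: (JS n) => [/ST/mT|->].
have mphiE : measurable_fun [set: X] (fun x => `|phi x|%:E).
  by apply/measurable_EFinP; exact: measurableT_comp.
rewrite -JE measure_bigcup_ae// -nneseriesZl//.
apply: (@le_trans _ _ (\int[mu]_(x in \bigcup_n J n) `|phi x|%:E)); last first.
  by apply: ge0_subset_integral => //; exact: bigcupT_measurable.
rewrite ge0_integral_bigcup_ae//; apply: lee_nneseries => n _.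
  by rewrite mule_ge0// lee_fin.
case: (JS n) => [[Tn]|->]; last by rewrite measure0 mule0 integral_set0.
by rewrite lte_tree_div// => /ltW.
Qed.

(** * Construction of the extremizers *)

(** Here [c] is the density of [A] in [U], and [g] a lower bound for the average over [U] of the
    maximal function of [M 1_A]. Both are relative to [U], so that the same constants serve all tree
    elements and can be glued. *)
Definition extremal_subset (M c g : R) (U : set X) : Prop := exists A : set X,
  [/\ measurable A, A `<=` U, mu A = c%:E * mu U &
    g%:E * mu U <=
      \int[mu]_(x in U) dyadic_maximal mu T (fun y => (M * \1_A y)%R) x].

Lemma measurable_scaled_indic (M : R) (A : set X) : measurable A ->
  measurable_fun [set: X] (fun y => (M * \1_A y)%R).
Proof. by move=> mA; apply: measurable_funM => //; exact: measurable_indic. Qed.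

Lemma integral_scaled_indic (M : R) (A I : set X) : measurable A -> measurable I ->
  (0 <= M)%R -> \int[mu]_(x in I) `|(M * \1_A x)%R|%:E = M%:E * mu (A `&` I).
Proof.
move=> mA mI M0; under eq_integral.
  by move=> x _; rewrite ger0_norm ?mulr_ge0// EFinM; over.
rewrite ge0_integralZl_EFin//; last first.
  by apply/measurable_EFinP; exact: measurable_funTS.
by rewrite integral_indic.
Qed.

Lemma scaled_indic_le (M : R) (A B : set X) y : (0 <= M)%R -> A `<=` B ->
  (`|M * \1_A y| <= `|M * \1_B y|)%R.
Proof.
move=> M0 AB; rewrite !normrM ler_wpM2l// !ger0_norm// !indicE ler_nat.
by have [/set_mem/AB/mem_set->|] := boolP (y \in A).
Qed.

(** The sets chosen in the maximal elements of [S] are united. Densities add up by almost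
    disjointness, and the lower bounds survive because the maximal function grows with the set. *)
Lemma extremal_subset_bigcup (M c g : R) (S : set (set X)) :
  (0 <= M)%R -> (0 <= c)%R -> (0 <= g)%R ->
  (forall I, T I -> extremal_subset M c g I) -> S `<=` T ->
  extremal_subset M c g (\bigcup_(I in S) I).
Proof.
move=> M0 c0 g0 extT ST.
have [J [JS <- J0]] := tree_maximal_sequence treeT ST.
have mJ n : measurable (J n) by case: (JS n) => [/ST/mT|->].
have /choice[A AJ] : forall n, exists A, [/\ measurable A, A `<=` J n,
    mu A = c%:E * mu (J n) &
    g%:E * mu (J n) <= \int[mu]_(x in J n)
      dyadic_maximal mu T (fun y => (M * \1_A y)%R) x].
  move=> n; case: (JS n) => [/ST/extT|->]; [exact|exists set0].
  by rewrite measure0 !mule0 integral_set0; split.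
have mA n : measurable (A n) by case: (AJ n).
have AsubJ n : A n `<=` J n by case: (AJ n).
have A0 m n : m <> n -> mu (A m `&` A n) = 0.
  move=> mn; apply: subset_measure0 (J0 _ _ mn); [exact: measurableI..|].
  exact: setISS.
have mUA : measurable (\bigcup_n A n) by exact: bigcupT_measurable.
exists (\bigcup_n A n); split=> //.
- exact: subset_bigcup.
- rewrite !measure_bigcup_ae// -nneseriesZl//.
  by apply: eq_eseriesr => n _; case: (AJ n).
- rewrite measure_bigcup_ae// -nneseriesZl//.
  rewrite ge0_integral_bigcup_ae//; last 2 first.
  + exact: measurable_maximal.
  + by move=> x; exact: maximal_ge0.
  apply: lee_nneseries => n _; first by rewrite mule_ge0// lee_fin.
  have [_ _ _ /le_trans] := AJ n; apply.
  apply: ge0_le_integral => //.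
  + by move=> x _; exact: maximal_ge0.
  + by apply: measurable_funTS; exact: measurable_maximal.
  + by apply: measurable_funTS; exact: measurable_maximal.
  + move=> x _; apply: le_maximal; [exact: measurable_scaled_indic..|].
    by move=> y; apply: scaled_indic_le => //; exact: bigcup_sup.
Qed.

(** One generation: take a union [U] of tree elements of relative measure [t] in [I], and place [A]
    inside [U] with density [c]. The part [U] contributes [t * g]; on the rest, of relative measure
    [1 - t], the maximal function is at least the average over [I] itself, which is
    [M * (t * c)]. *)
Lemma extremal_subset_step (M c g t : R) :
  (0 <= M)%R -> (0 <= c)%R -> (0 <= g)%R -> (0 <= t)%R -> (t <= 1)%R ->
  (forall I, T I -> extremal_subset M c g I) ->
  forall I, T I ->
    extremal_subset M (t * c)%R (t * g + M * (t * c) * (1 - t))%R I.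
Proof.
move=> M0 c0 g0 t0 t1 extT I TI; have mI := mT TI; have Ifin := tree_fineK TI.
have ST : [set I] `<=` T by move=> _ ->.
have [|| S [ST']] := @tree_bigcup_measure [set I] (t%:E * mu I) ST.
- by rewrite mule_ge0// lee_fin.
- by rewrite bigcup_set1 gee_pMl ?lee_fin// fin_num_measure.
rewrite bigcup_set1; set U := \bigcup_(J in S) J => UI Ut.
have mU : measurable U by exact: (measurable_tree_bigcup treeT).
have [A [mA AU Ac gA]] := extremal_subset_bigcup M0 c0 g0 extT ST'.
have AI : A `<=` I by exact: subset_trans UI.
have cA : mu A = (t * c)%:E * mu I by rewrite Ac Ut muleA EFinM [c%:E * _]muleC.
exists A; split=> //.
set h := dyadic_maximal mu T _ in gA *.
have mh : measurable_fun [set: X] h by exact: measurable_maximal.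
have h0 x : 0 <= h x by exact: maximal_ge0.
rewrite -[in leRHS](setDUK UI) ge0_integral_setU//; last 3 first.
- exact: measurableD.
- exact: measurable_funTS.
- by rewrite disj_set2E setDIK.
have mIU : mu (I `\` U) = (1 - t)%:E * mu I.
  have -> : mu (I `\` U) = mu I - mu U.
    by rewrite measureD ?(setIidr UI)// ltey_eq fin_num_measure.
  rewrite Ut -Ifin -!EFinM -EFinB; congr (_%:E); ring.
rewrite -Ifin -EFinM mulrDl EFinD; apply: leeD.
  apply: le_trans gA; rewrite Ut -Ifin -!EFinM lee_fin le_eqVlt; apply/orP; left.
  by apply/eqP; ring.
apply: (@le_trans _ _ (\int[mu]_(x in I `\` U) (cst (M * (t * c))%:E x))).
  have -> : \int[mu]_(x in I `\` U) cst (M * (t * c))%:E x =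
      (M * (t * c))%:E * mu (I `\` U).
    by rewrite integral_cst//; exact: measurableD.
  by rewrite mIU -Ifin -!EFinM lee_fin !mulrA.
apply: ge0_le_integral => //.
- exact: measurableD.
- by move=> x _; rewrite lee_fin !mulr_ge0.
- exact: measurable_funTS.
move=> x [Ix _]; apply: le_trans (average_le_maximal _ TI Ix).
by rewrite lee_tree_div// integral_scaled_indic// setIidl// cA muleA -EFinM.
Qed.

(** The recursion of the previous step starts from [A = I] with [c = 1] and [g = M]. After division
    by [t ^+ N], each generation adds the same amount [M * (1 - t)] to [g]. *)
Lemma extremal_subset_exp (M t : R) N : (0 <= M)%R -> (0 <= t)%R -> (t <= 1)%R ->
  forall I, T I ->
    extremal_subset M (t ^+ N)%R (M * (t ^+ N * (1 + N%:R * (1 - t))))%R I.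
Proof.
move=> M0 t0 t1; elim: N => [|N IHN] I TI.
  have mI := mT TI; exists I; rewrite expr0 mul1e; split=> //.
  rewrite mul0r addr0 mulr1 mulr1 -integral_cst//.
  apply: ge0_le_integral => //.
    by apply: measurable_funTS; exact: measurable_maximal.
  move=> x Ix; apply: le_trans (average_le_maximal _ TI Ix).
  by rewrite lee_tree_div// integral_scaled_indic// setIid.
have := extremal_subset_step M0 (exprn_ge0 N t0) _ t0 t1 IHN TI.
rewrite -exprS.
set g := (X in extremal_subset _ _ X _).
set g' := (X in _ -> extremal_subset _ _ X _).
have -> : g' = g by rewrite /g /g' exprS -natr1; ring.
apply; rewrite !mulr_ge0 ?exprn_ge0// addr_ge0 ?mulr_ge0 ?subr_ge0//.
Qed.

(** * Upper bounds for integrals of the maximal function *)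

(** Raising the truncation from [l] to [l * q] changes the integrand only where the maximal function
    exceeds [l], and by at most [l * (q - 1)]. By the weak-type estimate each of the [N] raises
    costs at most [q - 1] times the integral of [|phi|]. *)
Lemma maximal_truncated_integral (phi : X -> R) (K : set X) (c q : R) N :
  measurable K -> measurable_fun [set: X] phi -> (0 < c)%R -> (1 <= q)%R ->
  \int[mu]_(x in K) mine (dyadic_maximal mu T phi x) (c * q ^+ N)%:E
    <= c%:E * mu K + (N%:R * (q - 1))%:E * \int[mu]_x `|phi x|%:E.
Proof.
move=> mK mphi c0 q1; set h := dyadic_maximal mu T phi; set f := \int[mu]_x _.
have mh : measurable_fun [set: X] h by exact: measurable_maximal.
have h0 x : 0 <= h x by exact: maximal_ge0.
have cq0 n : (0 < c * q ^+ n)%R by rewrite mulr_gt0// exprn_gt0// (lt_le_trans ltr01).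
have mmin n : measurable_fun K (fun x => mine (h x) (c * q ^+ n)%:E).
  by apply: measurable_mine => //; exact: measurable_funTS.
have min0 n x : 0 <= mine (h x) (c * q ^+ n)%:E.
  by rewrite le_min h0 lee_fin ltW.
elim: N => [|N IHN].
  rewrite !mul0r mul0e adde0 -integral_cst//; apply: ge0_le_integral => //.
  by move=> x _; rewrite expr0 mulr1 ge_min lexx orbT.
set l := (c * q ^+ N)%R; have l0 : (0 <= l)%R by exact: ltW (cq0 N).
have lq0 : (0 <= l * (q - 1))%R by rewrite mulr_ge0 ?subr_ge0.
pose B := [set x | l%:E < h x].
have mB : measurable B.
  by rewrite /B maximal_gtE; apply: (measurable_tree_bigcup treeT) => I [].
apply: (@le_trans _ _ (\int[mu]_(x in K)
    (mine (h x) l%:E + ((l * (q - 1))%:E * (\1_B x)%:E)))).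
  apply: ge0_le_integral => //.
  - apply: emeasurable_funD; first exact: mmin.
    by apply: measurable_funTS; apply/measurable_EFinP; exact: measurable_scaled_indic.
  move=> x _; rewrite indicE; have [|] := boolP (x \in B).
    rewrite inE /B/= => lx; rewrite (min_r (ltW lx)) mule1 -EFinD ge_min.
    apply/orP; right; rewrite lee_fin exprS /l le_eqVlt; apply/orP; left.
    by apply/eqP; ring.
  rewrite notin_setE /B/= => /negP; rewrite -leNgt => xl.
  by rewrite mule0 adde0 (min_l xl) ge_min lexx.
rewrite ge0_integralD//; last 4 first.
- by move=> x _; exact: min0.
- exact: mmin.
- by move=> x _; rewrite mule_ge0// lee_fin// mulr_ge0 ?subr_ge0// ltW.
- by apply: measurable_funTS; apply/measurable_EFinP; exact: measurable_scaled_indic.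
rewrite ge0_integralZl_EFin//; last first.
  by apply/measurable_EFinP; exact: measurable_funTS.
rewrite integral_indic// -natr1 mulrDl mul1r EFinD ge0_muleDl; last 2 first.
- by rewrite lee_fin mulr_ge0// subr_ge0.
- by rewrite lee_fin subr_ge0.
rewrite addeA; apply: leeD => //.
rewrite [(l * _)%R]mulrC EFinM -muleA lee_wpmul2l ?lee_fin ?subr_ge0//.
apply: le_trans (maximal_weak_type mphi l0).
rewrite lee_wpmul2l ?lee_fin// le_measure ?inE//; exact: measurableI.
Qed.

Lemma tree_set_measure (a : R) : (0 <= a)%R -> (a <= 1)%R ->
  exists2 S, S `<=` T & mu (\bigcup_(I in S) I) = a%:E.
Proof.
move=> a0 a1; have [| || S [ST _ Sa]] := @tree_bigcup_measure [set setT] a%:E.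
- by move=> _ ->; exact: (tree_root treeT).
- by rewrite lee_fin.
- by rewrite bigcup_set1 probability_setT lee_fin.
- by exists S.
Qed.

Lemma maximal_integral_le_bound (phi : X -> R) (K : set X) (M : R) :
  measurable K -> measurable_fun [set: X] phi -> (0 <= M)%R ->
  {ae mu, forall x, (`|phi x| <= M)%R} ->
  \int[mu]_(x in K) dyadic_maximal mu T phi x <= M%:E * mu K.
Proof.
move=> mK mphi M0 phiM; rewrite -integral_cst//; apply: ge0_le_integral => //.
- by move=> x _; exact: maximal_ge0.
- by apply: measurable_funTS; exact: measurable_maximal.
- by move=> x _; exact: maximal_le_bound.
Qed.

End probability_tree.

(** * The essential supremum norm and the constraints on the extremizers *)

Section probability_space.
Context d (X : measurableType d) (R : realType) (mu : probability X R).

Lemma Lnormy_bound (phi : X -> R) (M : R) : 'N[mu]_+oo [EFin \o phi] = M%:E ->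
  {ae mu, forall x, (`|phi x| <= M)%R}.
Proof.
(* Positive total mass selects the case where the norm is the essential supremum. *)
have mu1 : 0 < mu setT by rewrite probability_setT.
rewrite unlock; case: ifPn => [_ phiM|/negP[]]; last exact: mu1.
apply: filterS (ess_sup_ge mu (abse \o (EFin \o phi))) => x.
by rewrite phiM.
Qed.

Lemma Lnormy_scaled_indic (M : R) (A : set X) : measurable A -> 0 < mu A ->
  (0 <= M)%R -> 'N[mu]_+oo [EFin \o (fun y => (M * \1_A y)%R)] = M%:E.
Proof.
move=> mA A0 M0; have mu1 : 0 < mu setT by rewrite probability_setT.
rewrite unlock; case: ifPn => [_|/negP[]]; last exact: mu1.
apply/eqP; rewrite eq_le; apply/andP; split.
  apply/ess_supP; apply: nearW => x /=; rewrite lee_fin normrM ger0_norm//.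
  by rewrite ler_piMr// indicE; case: (x \in A); rewrite ?normr1 ?normr0.
(* On [A] the function equals [M], so a smaller essential supremum would put [A] inside a null
   set. *)
rewrite leNgt; apply/negP => ltM.
have [N [mN N0 sN]] := ess_sup_ge mu (abse \o (EFin \o (fun y => (M * \1_A y)%R))).
have : mu A <= mu N.
  rewrite le_measure ?inE// => x Ax; apply: sN => /=.
  rewrite indicE mem_set// mulr1 ger0_norm// => /le_lt_trans/(_ ltM).
  by rewrite ltxx.
by rewrite N0 leNgt A0.
Qed.

Lemma scaled_indic_admissible (M f : R) (A : set X) : measurable A ->
  (0 < f)%R -> (0 < M)%R -> mu A = (f / M)%:E ->
  let phi y := (M * \1_A y)%R in
  [/\ measurable_fun [set: X] phi, forall x, (0 <= phi x)%R,
    \int[mu]_x (phi x)%:E = f%:E & 'N[mu]_+oo [EFin \o phi] = M%:E].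
Proof.
move=> mA f0 M0 Af phi; have phi0 x : (0 <= phi x)%R by rewrite mulr_ge0// ltW.
split=> //.
- exact: measurable_scaled_indic.
- under eq_integral do rewrite -(ger0_norm (phi0 _)).
  rewrite integral_scaled_indic//; last exact: ltW.
  by rewrite setIT Af -EFinM mulrC divfK// gt_eqF.
- by apply: Lnormy_scaled_indic => //; rewrite ?Af ?lte_fin ?divr_gt0// ltW.
Qed.

End probability_space.

(** * Exponential inequalities and the common limit of the two bounds *)

Section exponential_limits.
Context (R : realType).

(** This is [1 - t <= expR (- t)] multiplied by [expR t]. *)
Lemma expR_sub1_le (t : R) : (expR t - 1 <= t * expR t)%R.
Proof.
have : ((1 - t) * expR t <= expR (- t) * expR t)%R.
  by rewrite ler_wpM2r ?expR_ge0// expR_ge1Dx.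
by rewrite -expRD addNr expR0 mulrBl mul1r lerBlDr lerBlDl addrC.
Qed.

Lemma expR_1sub_ge (t : R) : (t * expR (- t) <= 1 - expR (- t))%R.
Proof. by have := expR_sub1_le (- t); rewrite mulNr -opprB lerN2. Qed.

(** Both bounds take this form with [a = f] and [b = f * L]: the upper one with [s = L], the lower
    one with [s = - L]. The number of steps is [n.+1], which keeps the quotient meaningful. *)
Lemma cvg_affine_expR (a b s : R) :
  (fun n => (a + b * expR (s / n.+1%:R))%:E) @ \oo --> (a + b)%:E.
Proof.
apply: cvg_EFin; first exact: nearW.
rewrite -[in X in _ --> X](mulr1 b); apply: cvgD; first exact: cvg_cst.
apply: cvgM; first exact: cvg_cst.
rewrite [X in _ --> X](_ : _ = expR (s * 0)); last by rewrite mulr0 expR0.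
apply: continuous_cvg; first exact: continuous_expR.
apply: cvgM; first exact: cvg_cst.
exact: cvg_harmonic.
Qed.

End exponential_limits.

(** * The supremum in the two ranges of [k] *)

Theorem theorem1p2 (d : measure_display) (X : measurableType d) (R : realType)
    (mu : probability X R) (T : set (set X)) (f M k : R) :
  nonatomic mu -> is_tree mu T ->
  (0 < f)%R -> (f <= M)%R -> (0 < k)%R -> (k <= 1)%R ->
  ereal_sup [set v : \bar R | exists (phi : X -> R) (K : set X),
      [/\ measurable_fun [set: X] phi, forall x, (0 <= phi x)%R,
          \int[mu]_x (phi x)%:E = f%:E & 'N[mu]_+oo [EFin \o phi] = M%:E] /\
      [/\ measurable K, mu K = k%:E &
          v = \int[mu]_(x in K) dyadic_maximal mu T phi x]]
  = (if (k <= f / M)%R then k * M else f + f * ln (M * k / f))%R%:E.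
Proof.
move=> _ [C treeT] f0 fM k0 k1; have M0 : (0 < M)%R by exact: lt_le_trans fM.
have fM1 : (f / M <= 1)%R by rewrite ler_pdivrMr// mul1r.
have fM0 : (0 < f / M)%R by rewrite divr_gt0.
have mT := measurable_tree_bigcup treeT.
case: ifPn => [kf|]; last first.
- rewrite -ltNge => fk; pose L := ln (M * k / f).
  have c1 : (1 < M * k / f)%R by rewrite ltr_pdivlMr// mul1r mulrC -ltr_pdivrMr.
  have c0 : (0 < M * k / f)%R by rewrite (lt_trans ltr01).
  have eL (s : R) n : (expR (s / n.+1%:R) ^+ n.+1 = expR s)%R.
    by rewrite -expRM_natl mulrC divfK// pnatr_eq0.
  apply/eqP; rewrite eq_le; apply/andP; split.
  + apply: ge_ereal_sup => _ [phi [K [[mphi phi0 phif phiM] [mK Kk ->]]]].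
    (* The target value is replaced by this limit, and every term of the sequence is shown to be an
       upper bound. *)
    have lim := @cvg_affine_expR R f (f * L)%R L.
    rewrite -(cvg_lim _ lim)//; apply: lime_ge; first by
      apply/cvg_ex; eexists; exact: lim.
    apply: nearW => n; set q := expR (L / n.+1%:R)%R.
    have q1 : (1 <= q)%R by rewrite -[leLHS]expR0 ler_expR divr_ge0// ln_ge0// ltW.
    (* The truncation starts at [f / k], whose product with the measure of [K] is [f], and after
       [n.+1] factors [q] it reaches [M]. There it is void, as the maximal function never exceeds
       [M]. *)
    have := maximal_truncated_integral treeT n.+1 mK mphi (divr_gt0 f0 k0) q1.
    rewrite eL lnK ?posrE// (_ : (f / k * _)%R = M); last first.
      by field; rewrite !gt_eqF.
    under eq_integral.
      move=> x _; rewrite min_l; last first.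
        exact: (maximal_le_bound treeT _ mphi (ltW M0) (Lnormy_bound phiM)).
      over.
    move=> /le_trans; apply.
    under eq_integral do rewrite ger0_norm//.
    rewrite phif Kk -!EFinM -EFinD lee_fin divfK ?gt_eqF// lerD2l mulrC.
    rewrite -mulrA ler_pM2l//.
    apply: (@le_trans _ _ (n.+1%:R * (L / n.+1%:R * q))%R).
      by rewrite ler_wpM2l// expR_sub1_le.
    by rewrite mulrA [(_ * (L / _))%R]mulrC divfK// pnatr_eq0.
  + have lim := @cvg_affine_expR R f (f * L)%R (- L)%R.
    rewrite -(cvg_lim _ lim)//; apply: lime_le; first by
      apply/cvg_ex; eexists; exact: lim.
    apply: nearW => n; set t := expR (- L / n.+1%:R)%R.
    have t0 : (0 <= t)%R by exact: expR_ge0.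
    have t1 : (t <= 1)%R by rewrite expR_le1 mulNr oppr_le0 divr_ge0// ln_ge0// ltW.
    (* With this density in a set of measure [k], [A] has measure [f / M], as the constraint on the
       integral of [M 1_A] requires. *)
    have tn : (t ^+ n.+1 = f / (M * k))%R by rewrite eL expRN lnK ?posrE// invf_div.
    have [S ST Sk] := tree_set_measure treeT (ltW k0) k1.
    have := extremal_subset_bigcup treeT (ltW M0) (exprn_ge0 _ t0) _
      (extremal_subset_exp treeT n.+1 (ltW M0) t0 t1) ST.
    rewrite tn => -[|A [mA AS]].
      by rewrite !mulr_ge0 ?invr_ge0 ?addr_ge0 ?mulr_ge0 ?subr_ge0// ltW.
    rewrite Sk => Af fA.
    apply: (@le_trans _ _ (\int[mu]_(x in \bigcup_(I in S) I)
        dyadic_maximal mu T (fun y => (M * \1_A y)%R) x)); last first.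
      apply: ereal_sup_ubound; exists (fun y => (M * \1_A y)%R), (\bigcup_(I in S) I).
      split; last by split=> //; exact: mT.
      apply: scaled_indic_admissible => //; rewrite Af -EFinM; congr (_%:E).
      by field; rewrite !gt_eqF.
    apply: le_trans fA; rewrite -EFinM lee_fin.
    rewrite (_ : (M * _ * k)%R = (f + f * (n.+1%:R * (1 - t)))%R); last first.
      by field; rewrite !gt_eqF.
    rewrite lerD2l -mulrA ler_pM2l//.
    apply: (@le_trans _ _ (n.+1%:R * (L / n.+1%:R * t))%R).
      by rewrite mulrA [(_ * (L / _))%R]mulrC divfK// pnatr_eq0.
    by rewrite ler_wpM2l// /t mulNr expR_1sub_ge.
- apply/eqP; rewrite eq_le; apply/andP; split.
  + apply: ge_ereal_sup => _ [phi [K [[mphi phi0 phif phiM] [mK Kk ->]]]].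
    have := maximal_integral_le_bound treeT mK mphi (ltW M0) (Lnormy_bound phiM).
    by rewrite Kk -EFinM mulrC.
  (* For small [k], choose [A] of measure [f / M] and then [K] inside [A] of measure [k], both
     unions of tree elements. Each element composing [K] lies in [A], so [M 1_A] has average [M] on
     it, and the maximal function is at least [M] on [K]. *)
  + have [S ST Sf] := tree_set_measure treeT (ltW fM0) fM1.
    have [||S' [S'T S'S S'k]] := tree_bigcup_measure treeT (a := k%:E) ST.
    * by rewrite lee_fin ltW.
    * by rewrite Sf lee_fin.
    set A := \bigcup_(I in S) I in S'S Sf; set K := \bigcup_(I in S') I in S'S S'k.
    have mA : measurable A by exact: mT.
    have mK : measurable K by exact: mT.
    apply: (@le_trans _ _ (\int[mu]_(x in K)
        dyadic_maximal mu T (fun y => (M * \1_A y)%R) x)); last first.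
      apply: ereal_sup_ubound; exists (fun y => (M * \1_A y)%R), K.
      by split=> //; exact: scaled_indic_admissible.
    rewrite mulrC EFinM -S'k -integral_cst//; apply: ge0_le_integral => //.
    * by move=> x _; rewrite lee_fin ltW.
    * by apply: measurable_funTS; exact: (measurable_maximal treeT).
    move=> x [I S'I Ix]; have TI := S'T _ S'I; have mI := tree_measurable treeT TI.
    apply: le_trans (average_le_maximal mu _ TI Ix).
    have IA : I `<=` A by apply: subset_trans S'S; exact: bigcup_sup.
    by rewrite (lee_tree_div treeT)// integral_scaled_indic ?(setIidr IA)// ltW.
Qed.
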